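(* Let $n \geq 1$. The dihedral group $\mathbf{D}_{2n} = \langle r, s \mid r^n = 1, s^2 = 1, srs^{-1} = r^{-1}\rangle$ of order $2n$ is fully realizable if and only if $n = 1$ or $n = 2$.
   Context: Rings are associative with identity and ring homomorphisms preserve the identity. $R^\times$ is the group of units of a ring $R$; a ring endomorphism $\psi$ of $R$ restricts to a group endomorphism $\psi^\times$ of $R^\times$. A group $G$ is fully realizable if there is a ring $R$ with $R^\times = G$ (up to isomorphism) such that every group endomorphism of $G$ is of the form $\psi^\times$ for some ring endomorphism $\psi$ of $R$. *)

(* Defs.v *)
From HB Require Import structures.
From mathcomp Require Import all_boot all_order all_algebra.
From mathcomp Require Import all_fingroup all_solvable.

Set Implicit Arguments.
Unset Strict Implicit.
Unset Printing Implicit Defensive.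

Import GRing.Theory.

Section Units.

Variable R : pzRingType.

Local Open Scope ring_scope.

(* A unit is stored together with its two-sided inverse; the inverse being     *)
(* unique, [unit_val] is injective and its image is the set of invertible      *)
(* elements of R (lemmas [unit_val_inj] and [unit_valP] below).                *)
Record units := Units {
  unit_pair : R * R;
  _ : (unit_pair.1 * unit_pair.2 == 1) && (unit_pair.2 * unit_pair.1 == 1) }.

HB.instance Definition _ := [isSub for unit_pair].
HB.instance Definition _ := [Choice of units by <:].

Definition unit_val (u : units) : R := (unit_pair u).1.
Definition unit_inv (u : units) : R := (unit_pair u).2.

Lemma unit_valK u : unit_val u * unit_inv u = 1.
Proof. by case: u => -[x y] Pu; case/andP: (Pu) => /eqP. Qed.

Lemma unit_invK u : unit_inv u * unit_val u = 1.
Proof. by case: u => -[x y] Pu; case/andP: (Pu) => _ /eqP. Qed.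

Lemma unit_val_inj : injective unit_val.
Proof.
move=> u v eq_uv; have eq_inv : unit_inv u = unit_inv v.
  rewrite -[LHS]mulr1 -(unit_valK v) mulrA -eq_uv.
  by rewrite unit_invK mul1r.
apply: val_inj; rewrite /= [LHS]surjective_pairing [RHS]surjective_pairing.
by congr pair.
Qed.

Lemma unit_valP x :
  (exists u, unit_val u = x) <-> (exists y, x * y = 1 /\ y * x = 1).
Proof.
split=> [[u <-]|[y [xy yx]]].
  by exists (unit_inv u); rewrite unit_valK unit_invK.
have Pxy : (x * y == 1) && (y * x == 1) by rewrite xy yx eqxx.
by exists (@Units (x, y) Pxy).
Qed.

Fact units_one_subproof : ((1 : R) * 1 == 1) && ((1 : R) * 1 == 1).
Proof. by rewrite mulr1 eqxx. Qed.

Definition units_one : units := @Units (1, 1) units_one_subproof.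

Fact units_mul_subproof (u v : units) :
  (unit_val u * unit_val v * (unit_inv v * unit_inv u) == 1)
  && (unit_inv v * unit_inv u * (unit_val u * unit_val v) == 1).
Proof.
rewrite mulrA -[X in X * unit_inv u]mulrA unit_valK mulr1 unit_valK eqxx /=.
by rewrite mulrA -[X in X * unit_val v]mulrA unit_invK mulr1 unit_invK eqxx.
Qed.

Definition units_mul (u v : units) : units :=
  @Units (unit_val u * unit_val v, unit_inv v * unit_inv u)
         (units_mul_subproof u v).

Fact units_inv_subproof (u : units) :
  (unit_inv u * unit_val u == 1) && (unit_val u * unit_inv u == 1).
Proof. by rewrite unit_valK unit_invK eqxx. Qed.

Definition units_inv (u : units) : units :=
  @Units (unit_inv u, unit_val u) (units_inv_subproof u).

Fact units_mulA : associative units_mul.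
Proof. by move=> u v w; apply: unit_val_inj; apply: mulrA. Qed.

Fact units_mul1 : left_id units_one units_mul.
Proof. by move=> u; apply: unit_val_inj; apply: mul1r. Qed.

Fact units_1mul : right_id units_one units_mul.
Proof. by move=> u; apply: unit_val_inj; apply: mulr1. Qed.

Fact units_mulV : left_inverse units_one units_inv units_mul.
Proof. by move=> u; apply: unit_val_inj; apply: unit_invK. Qed.

Fact units_Vmul : right_inverse units_one units_inv units_mul.
Proof. by move=> u; apply: unit_val_inj; apply: unit_valK. Qed.

HB.instance Definition _ := isGroup.Build units
  units_mulA units_mul1 units_1mul units_mulV units_Vmul.

End Units.

Section UnitsMap.

Variables (R S : pzRingType) (psi : {rmorphism R -> S}).

Local Open Scope ring_scope.

Fact units_map_subproof (u : units R) :
  (psi (unit_val u) * psi (unit_inv u) == 1)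
  && (psi (unit_inv u) * psi (unit_val u) == 1).
Proof. by rewrite -!rmorphM unit_valK unit_invK rmorph1 eqxx. Qed.

Definition units_map (u : units R) : units S :=
  @Units S (psi (unit_val u), psi (unit_inv u)) (units_map_subproof u).

Fact units_map_is_multiplicative : {morph units_map : u v / (u * v)%g}.
Proof. by move=> u v; apply: unit_val_inj; apply: rmorphM. Qed.

HB.instance Definition _ :=
  isMultiplicative.Build (units R) (units S) units_map
    units_map_is_multiplicative.

End UnitsMap.

(* Every multiplicative map between groups preserves the identity, so          *)
(* [{multiplicative G -> G}] is the type of group endomorphisms of G.          *)
Definition fully_realizable (G : groupType) : Prop :=
  exists (R : pzRingType) (phi : {multiplicative G -> units R}),
    bijective phi
    /\ forall f : {multiplicative G -> G},
         exists psi : {rmorphism R -> R},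
           forall g : G, phi (f g) = units_map psi (phi g).

(* In general [Grp] presents the largest finite quotient of the presented      *)
(* group; for n > 0 this presentation defines a finite group, so it determines *)
(* D_{2n} up to isomorphism (see [is_dihedral_card], [is_dihedral_exists]).    *)
Definition is_dihedral (n : nat) (gT : finGroupType) : Prop :=
  ([set: gT] \isog Grp (r : s : r ^+ n = 1, s ^+ 2 = 1, s * r * s^-1 = r^-1))%g.

Section Dihedral.

Local Open Scope group_scope.

Lemma is_dihedral_exists n : 0 < n ->
  exists gT : finGroupType, is_dihedral n gT /\ #|gT| = n.*2.
Proof.
case: n => [//|[|n]] _; last first.
  have n1 : 1 < n.+2 by [].
  exists ('D_(n.+2.*2))%type; split; last first.
    by rewrite -cardsT card_dihedral.
  have G := Grp_dihedral n1.
  move=> rT H; rewrite G; apply/existsP/existsP => -[[x y]] /=.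
    move=> /eqP[defH xn y2 xy]; exists (x, y); rewrite /= !xpair_eqE.
    rewrite defH xn y2 !eqxx /= -mulgA.
    have Vy : y^-1 = y by apply/eqP; rewrite eq_invg_mul; apply/eqP.
    by rewrite -xy /conjg Vy.
  move=> /eqP[defH xn y2 xy]; exists (x, y); rewrite /= !xpair_eqE.
  rewrite defH xn y2 !eqxx /=.
  have Vy : y^-1 = y by apply/eqP; rewrite eq_invg_mul; apply/eqP.
  by rewrite -xy /conjg Vy mulgA.
exists ('Z_2 : finGroupType); split; last by rewrite card_ord.
have genZ2 : [set: 'Z_2] = <[Zp1]> by exact: (Zp_cycle 1).
apply: (intro_isoGrp (G := [group of [set: 'Z_2]])).
  apply/existsP; exists (1, Zp1); rewrite /= !xpair_eqE /=.
  rewrite cycle1 joing1G.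
  by rewrite genZ2 mulg1 mulgV invg1 !eqxx.
move=> rT H /existsP[[x y]] /= /eqP[defH x1 y2 _].
rewrite expg1 in x1; rewrite -defH x1 cycle1 joing1G.
rewrite genZ2.
apply/homgP.
have dvdy : #[y] %| #[Zp1 : 'Z_2] by rewrite order_Zp1 order_dvdn y2.
exists (eltm_morphism dvdy).
by rewrite im_eltm.
Qed.

Lemma is_dihedral_isog n (gT hT : finGroupType) :
  is_dihedral n gT -> is_dihedral n hT -> [set: gT] \isog [set: hT].
Proof.
move=> Dg Dh.
have hg := Dg gT [group of [set: gT]]; have hh := Dh hT [group of [set: hT]].
have gh := Dg hT [group of [set: hT]]; have hg' := Dh gT [group of [set: gT]].
by rewrite isogEhom /= hg' gh -hg -hh !homg_refl.
Qed.

Lemma is_dihedral_card n (gT : finGroupType) :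
  0 < n -> is_dihedral n gT -> #|gT| = n.*2.
Proof.
move=> /is_dihedral_exists[hT [Dh <-]] Dg.
by rewrite -!cardsT; apply/card_isog/(is_dihedral_isog Dg Dh).
Qed.

End Dihedral.

(* Main.v *)
(* Realizability: a group V of exponent 2 is the unit group {1 + v} of the
   square-zero extension of F_2 by V, functorially in V.
   Conversely let R realize D_2n with n > 2. Lifting the trivial endomorphism
   gives -1 = 1 in R. For x = 1 + s, the element c = x r x squares to 0, so 1 + c
   is a unit; lifting the endomorphism r |-> 1, s |-> s shows that it is a power
   of r, so c commutes with r, which forces (r + r^-1)^2 = 0, hence r^4 = 1 and
   n = 4. Then d = x (1 + r) satisfies d^3 = 0, so 1 + d is a unit g; lifting
   r |-> 1, s |-> s and r |-> s, s |-> 1 shows that g is a power of r^2, hence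
   g is fixed by the automorphism r |-> r^-1, s |-> s r, but the lift of the
   latter only fixes 1 + d when r = r^-1. *)

Require Import Defs.
From HB Require Import structures.
From mathcomp Require Import all_boot all_order all_algebra.
From mathcomp Require Import all_fingroup all_solvable.

Set Implicit Arguments.
Unset Strict Implicit.
Unset Printing Implicit Defensive.

Import GRing.Theory.


(** * Group endomorphisms: identity and powers *)

Section Endomorphisms.

Local Open Scope group_scope.

(* [gmulf1] and [gmulfXn] require a [UMagmaMorphism] structure, which is not
   inferred from a [{multiplicative _ -> _}]. *)
Lemma multiplicative1 (G H : groupType) (f : {multiplicative G -> H}) : f 1 = 1.
Proof. by apply: (mulgI (f 1)); rewrite -gmulfM !mulg1. Qed.

Lemma multiplicativeX (G H : groupType) (f : {multiplicative G -> H}) k :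
  {morph f : x / x ^+ k}.
Proof.
by move=> x; elim: k => [|k IH]; rewrite ?expg0 ?multiplicative1 // !expgS gmulfM IH.
Qed.

End Endomorphisms.

(** * Realizing groups of exponent dividing 2 *)

Section SquareZeroExtension.

Variables (G : groupType) (sq1 : forall x : G, (x * x = 1)%g).

Local Open Scope group_scope.

Lemma invg_sq1 (x : G) : x^-1 = x.
Proof. by apply: (mulgI x); rewrite mulgV sq1. Qed.

Lemma mulgC_sq1 (x y : G) : x * y = y * x.
Proof. by rewrite -[x * y]invg_sq1 invgM !invg_sq1. Qed.

(** [(a, x)] stands for [a + x], with [a] in F_2 and [G] written additively as an ideal of square
    zero. The phantom proof argument lets the ring instances, whose axioms rely on it, attach to the
    type. *)
Definition sqz_ext of (forall x : G, x * x = 1) : Type := (bool * G)%type.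

Local Notation E := (sqz_ext sq1).

HB.instance Definition _ := Choice.on E.

Let zero : E := (false, 1).
Let one : E := (true, 1).
Let add (a b : E) : E := (a.1 (+) b.1, a.2 * b.2).
Let mul (a b : E) : E :=
  (a.1 && b.1, (if b.1 then a.2 else 1) * (if a.1 then b.2 else 1)).

Fact sqz_addA : associative add.
Proof. by move=> [a x] [b y] [c z]; rewrite /add /= addbA mulgA. Qed.

Fact sqz_addC : commutative add.
Proof. by move=> [a x] [b y]; rewrite /add /= addbC mulgC_sq1. Qed.

Fact sqz_add0 : left_id zero add.
Proof. by move=> [a x]; rewrite /add /= mul1g. Qed.

Fact sqz_addN : left_inverse zero id add.
Proof. by move=> [a x]; rewrite /add /= addbb sq1. Qed.

HB.instance Definition _ :=
  GRing.isZmodule.Build E sqz_addA sqz_addC sqz_add0 sqz_addN.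

Fact sqz_mulA : associative mul.
Proof.
by move=> [[] x] [[] y] [[] z]; rewrite /mul /= ?mulg1 ?mul1g ?mulgA.
Qed.

Fact sqz_mul1 : left_id one mul.
Proof. by move=> [[] x]; rewrite /mul /= ?mulg1 ?mul1g. Qed.

Fact sqz_1mul : right_id one mul.
Proof. by move=> [[] x]; rewrite /mul /= ?mulg1 ?mul1g. Qed.

Fact sqz_mulDl : left_distributive mul +%R.
Proof.
have zxz (x z : G) : z * (x * z) = x by rewrite (mulgC_sq1 x) mulgA sq1 mul1g.
move=> [[] x] [[] y] [[] z]; rewrite /mul /= /GRing.add /= /add /=;
  rewrite ?mulg1 ?mul1g ?sq1 -?mulgA ?zxz //.
by rewrite (mulgC_sq1 y).
Qed.

Fact sqz_mulC : commutative mul.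
Proof.
by move=> [[] x] [[] y]; rewrite /mul /= ?mulg1 ?mul1g // mulgC_sq1.
Qed.

Fact sqz_mulDr : right_distributive mul +%R.
Proof. by move=> x y z; rewrite sqz_mulC sqz_mulDl !(sqz_mulC x). Qed.

HB.instance Definition _ := GRing.Zmodule_isPzRing.Build E
  sqz_mulA sqz_mul1 sqz_1mul sqz_mulDl sqz_mulDr.

Fact sqz_unit_subproof (g : G) :
  (((true, g) : E) * (true, g) == 1)%R && (((true, g) : E) * (true, g) == 1)%R.
Proof. by rewrite andbb /GRing.mul /= /mul /= sq1. Qed.

Definition sqz_unit (g : G) : units E :=
  @Units E ((true, g), (true, g)) (sqz_unit_subproof g).

Fact sqz_unit_is_multiplicative : {morph sqz_unit : u v / u * v}.
Proof. by move=> x y; apply: unit_val_inj. Qed.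

HB.instance Definition _ := isMultiplicative.Build G (units E) sqz_unit
  sqz_unit_is_multiplicative.

(** First components multiply by conjunction, so that of a unit is [true]. *)
Lemma sqz_unit_bij : bijective sqz_unit.
Proof.
exists (fun u : units E => (unit_val u).2) => // u; apply: unit_val_inj.
rewrite [LHS](_ : _ = (true, (unit_val u).2)) //.
have := unit_valK u; rewrite /GRing.mul /= /mul; case: (unit_val u) => a x /=.
by case: a => //; case.
Qed.

Section Map.

Variable f : {multiplicative G -> G}.

Definition sqz_map (a : E) : E := (a.1, f a.2).

Fact sqz_map_is_additive : zmod_morphism sqz_map.
Proof. by move=> [a x] [b y]; congr pair; exact: gmulfM. Qed.

Fact sqz_map_is_multiplicative : monoid_morphism sqz_map.
Proof.
split=> [|[a x] [b y]]; first by congr pair; exact: (multiplicative1 f).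
by rewrite /sqz_map /GRing.mul /= /mul /= gmulfM; case: a b => [] [];
  rewrite /= ?multiplicative1.
Qed.

HB.instance Definition _ := GRing.isZmodMorphism.Build E E sqz_map
  sqz_map_is_additive.
HB.instance Definition _ := GRing.isMonoidMorphism.Build E E sqz_map
  sqz_map_is_multiplicative.

End Map.

(** An endomorphism of [G], extended by the identity on F_2, respects both ring operations. *)
Lemma sq1_fully_realizable : fully_realizable G.
Proof.
exists E, sqz_unit; split; first exact: sqz_unit_bij.
by move=> f; exists (sqz_map f) => g; apply: unit_val_inj.
Qed.

End SquareZeroExtension.

(** * Structure and endomorphisms of dihedral groups *)

Section DihedralGroup.

Local Open Scope group_scope.

Definition dihedral_rel (gT : finGroupType) n (r s : gT) :=
  [/\ r ^+ n = 1, s ^+ 2 = 1 & s * r * s^-1 = r^-1].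

Variables (n : nat) (gT : finGroupType).
Hypotheses (n_gt0 : 0 < n) (gT_dihedral : is_dihedral n gT).

Lemma dihedral_gen :
  exists r s : gT, <[r]> <*> <[s]> = [set: gT] /\ dihedral_rel n r s.
Proof.
have := @gT_dihedral gT [group of [set: gT]].
rewrite homg_refl => /esym/existsP[[r s]] /= /eqP[defG rn s2 rs].
by exists r, s.
Qed.

(** By the presentation, this subgroup is a homomorphic image of [gT]. *)
Lemma card_dihedral_rel (rT : finGroupType) (x y : rT) :
  dihedral_rel n x y -> #|<[x]> <*> <[y]>| <= n.*2.
Proof.
case=> xn y2 xy; rewrite -(is_dihedral_card n_gt0 gT_dihedral) -cardsT.
apply/leq_homg; rewrite (@gT_dihedral rT (<[x]> <*> <[y]>)%G).
by apply/existsP; exists (x, y); rewrite /= !xpair_eqE xn y2 xy !eqxx.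
Qed.

Variables r s : gT.
Hypotheses (defG : <[r]> <*> <[s]> = [set: gT]) (rs_rel : dihedral_rel n r s).

(* Von Dyck: the subgroup of gT * gT generated by (r, x) and (s, y) satisfies
   the dihedral relations, so it has at most 2n elements; as it projects onto
   gT, it is the graph of the endomorphism. *)
Lemma dihedral_endo (x y : gT) : dihedral_rel n x y ->
  exists f : {multiplicative gT -> gT}, f r = x /\ f s = y.
Proof.
move=> [xn y2 xy]; have [rn s2 rs] := rs_rel.
pose H := (<[(r, x)]> <*> <[(s, y)]>)%G.
have expgP (a b : gT) k : (a, b) ^+ k = (a ^+ k, b ^+ k).
  by elim: k => [//|k IH]; rewrite !expgS IH.
have leH : #|H| <= #|gT|.
  rewrite (is_dihedral_card n_gt0 gT_dihedral) card_dihedral_rel //.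
  by split; rewrite ?expgP ?rn ?xn ?s2 ?y2 //; congr pair.
have rH : (r, x) \in H by rewrite mem_gen // inE cycle_id.
have sH : (s, y) \in H by rewrite mem_gen // inE cycle_id orbT.
have fstH : fst @: H = [set: gT].
  rewrite -[LHS](morphimEsub _ (subsetT H)) morphimY ?subsetT //=.
  by rewrite !morphim_cycle ?inE.
have injH : {in H &, injective fst}.
  by apply/imset_injP; rewrite eqn_leq leq_imset_card fstH cardsT.
have ex g : exists h, (g, h) \in H.
  have: g \in fst @: H by rewrite fstH inE.
  by case/imsetP => -[a b] abH /= ->; exists b.
pose f g := xchoose (ex g).
have fH g : (g, f g) \in H by exact: (xchooseP (ex g)).
have fE g h : (g, h) \in H -> f g = h.
  by move=> ghH; case: (injH _ _ (fH g) ghH erefl).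
have fM : {morph f : a b / a * b}.
  by move=> a b; apply: fE; exact: (groupM (fH a) (fH b)).
pose F := isMultiplicative.Build gT gT f fM.
exists (HB.pack f F : {multiplicative gT -> gT}).
by split; apply: fE.
Qed.

Lemma dihedral_conj : r ^ s = r^-1.
Proof.
have [_ s2 <-] := rs_rel; rewrite conjgE -mulgA; congr (_ * (_ * _)).
  by apply/eqP; rewrite eq_invg_mul -expg2 s2.
by apply/eqP; rewrite eq_sym eq_invg_mul -expg2 s2.
Qed.

Lemma dihedral_mul : <[r]> * <[s]> = [set: gT].
Proof.
rewrite -norm_joinEr ?defG // cycle_subG inE -cycleJ dihedral_conj.
by rewrite cycle_subG groupV cycle_id.
Qed.

Lemma dihedral_elt g : exists k, g = r ^+ k \/ g = r ^+ k * s.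
Proof.
have [_ s2 _] := rs_rel.
have: g \in <[r]> * <[s]> by rewrite dihedral_mul inE.
case/mulsgP=> _ _ /cycleP[i ->] /cycleP[j ->] ->; exists i.
rewrite -(odd_double_half j) expgD -mul2n expgM s2 expg1n mulg1.
by case: (odd j); [right | left; rewrite mulg1].
Qed.

(** Counting: [2n] is at most [#[r] * #[s]], hence at most [2 * #[r]], while [#[r]] divides [n]. *)
Lemma dihedral_order : n %| #[r].
Proof.
have [rn s2 _] := rs_rel.
have ord_r : #[r] %| n by rewrite order_dvdn rn.
have ord_s : #[s] <= 2 by rewrite dvdn_leq // order_dvdn s2.
suff -> : #[r] = n by [].
apply/eqP; rewrite eqn_leq dvdn_leq //=.
have := mul_cardG <[r]> <[s]>; rewrite dihedral_mul cardsT.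
rewrite (is_dihedral_card n_gt0 gT_dihedral) -!orderE => E.
have: n.*2 <= #[r] * #[s] by rewrite E leq_pmulr // cardG_gt0.
move/leq_trans/(_ (leq_mul (leqnn _) ord_s)).
by rewrite -muln2 leq_pmul2r.
Qed.

Lemma dihedral_gen_neq1 : s != 1.
Proof.
have [rn s2 _] := rs_rel; apply/eqP => s1.
have := is_dihedral_card n_gt0 gT_dihedral.
rewrite -cardsT -dihedral_mul s1 cycle1 mulg1 -orderE => E.
have: #[r] <= n by rewrite dvdn_leq // order_dvdn rn.
by rewrite E -addnn -{3}[n]addn0 leq_add2l leqNgt n_gt0.
Qed.

End DihedralGroup.

(** Here [r^-1 = r], so [r] and [s] commute and both square to 1. *)
Lemma dihedral_sq1 n (gT : finGroupType) : 0 < n -> n %| 2 ->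
  is_dihedral n gT -> forall x : gT, (x * x = 1)%g.
Proof.
move=> n_gt0 n2 D x; have [r [s [defG rs_rel]]] := dihedral_gen D.
have [rn s2 _] := rs_rel.
have r2 : (r ^+ 2 = 1)%g by case/dvdnP: n2 => k ->; rewrite mulnC expgM rn expg1n.
have rV : (r^-1 = r)%g by apply/eqP; rewrite eq_invg_mul -expg2 r2.
have rs : commute r s by apply/commgP/conjg_fixP; rewrite (dihedral_conj rs_rel).
have [k [->|->]] := dihedral_elt defG rs_rel x.
  by rewrite -expg2 expgAC r2 expg1n.
rewrite -expg2 expgMn; last by apply/commute_sym/commuteX/commute_sym.
by rewrite expgAC r2 expg1n s2 mulg1.
Qed.

(** * Identities in a ring with [1 + 1 = 0]; [q] is the inverse of [r], and conjugation by [s]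
    exchanges them *)

Section Char2.

Local Open Scope ring_scope.

Variables (R : pzRingType) (r q s : R).
Hypotheses (R2 : forall x : R, x + x = 0) (rq : r * q = 1) (qr : q * r = 1)
  (s2 : s * s = 1) (rs : r * s = s * q).

Lemma addr_char2_eq (a b : R) : a + b = 0 -> a = b.
Proof. by move=> ab; rewrite -[b]add0r -(R2 a) -addrA ab addr0. Qed.

Let x := 1 + s.

Lemma involution_sq0 : x * x = 0.
Proof. by rewrite mulrDr mulr1 mulrDl mul1r s2 [s + 1]addrC R2. Qed.

Lemma sq0_unit (c : R) : c * c = 0 -> (1 + c) * (1 + c) = 1.
Proof. by move=> c2; rewrite mulrDr mulr1 mulrDl mul1r c2 addr0 -addrA R2 addr0. Qed.

(** The inverse is the truncated geometric series; signs vanish in characteristic 2. *)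
Lemma cube0_unit (d : R) : d * d * d = 0 ->
  (1 + d) * (1 + d + d * d) = 1 /\ (1 + d + d * d) * (1 + d) = 1.
Proof.
move=> d3.
have E : (1 + d + d * d) + d * (1 + d + d * d) = 1.
  rewrite !mulrDr mulr1 mulrA d3 addr0 -!addrA [d * d + _]addrC.
  by rewrite -[d + d * d + _]addrA R2 addr0 R2 addr0.
split; first by rewrite mulrDl mul1r.
by rewrite -[RHS]E mulrDr mulr1; congr (_ + _); rewrite !mulrDl !mulrDr mulr1 mul1r mulrA.
Qed.

(** Since [x * s = x], the term [x * r * s = x * s * q] collapses to [x * q]. *)
Lemma conj_rot : x * r * x = x * (r + q).
Proof.
have xs : x * s = x by rewrite mulrDl mul1r s2 addrC.
by rewrite -mulrA [r * x]mulrDr mulr1 rs !mulrDr [x * (s * q)]mulrA xs.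
Qed.

(* Since [r x + x r = s (r + q)], the hypothesis gives [s (r + q)^2 = 0]. *)
Lemma rot_sq_eq : r * (x * r * x) = x * r * x * r -> r * r = q * q.
Proof.
rewrite conj_rot => H; apply: addr_char2_eq.
have tr : (r + q) * r = r * (r + q) by rewrite mulrDl mulrDr rq qr.
have : (r * x + x * r) * (r + q) = 0.
  by rewrite mulrDl -!mulrA H -!mulrA tr R2.
have -> : r * x + x * r = s * (r + q).
  by rewrite mulrDr mulrDl mulr1 mul1r rs addrACA R2 add0r addrC mulrDr.
move=> /(congr1 ( *%R s)); rewrite mulr0 !mulrA s2 mul1r.
by rewrite mulrDr !mulrDl rq qr -addrA [1 + _]addrA R2 add0r.
Qed.

(** As [x * x = 0], the square is [x * r * x * (1 + r)]; moving [1 + r] to the left puts two factors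
    [x] side by side in the cube. *)
Lemma rot_cube0 : r * (x * r * x) = x * r * x * r ->
  x * (1 + r) * (x * (1 + r)) * (x * (1 + r)) = 0.
Proof.
move=> H; have x2 := involution_sq0.
have E : x * (1 + r) * (x * (1 + r)) = x * r * x * (1 + r).
  by rewrite [X in X * _ = _]mulrDr mulr1 mulrDl !mulrA x2 mul0r add0r.
rewrite E.
have -> : x * r * x * (1 + r) = (1 + r) * (x * r * x).
  by rewrite [LHS]mulrDr [RHS]mulrDl mulr1 mul1r H.
by rewrite -!mulrA [x * (x * _)]mulrA x2 mul0r !mulr0.
Qed.

End Char2.

(** * Dihedral groups with [n > 2] are not fully realizable *)

Section NotRealizable.

Variables (n : nat) (gT : finGroupType) (r s : gT).
Hypotheses (n_gt2 : 2 < n) (gT_dihedral : is_dihedral n gT).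
Hypotheses (defG : (<[r]> <*> <[s]> = [set: gT])%g) (rs_rel : dihedral_rel n r s).
Variables (R : pzRingType) (phi : {multiplicative gT -> units R}).
Hypotheses (phi_bij : bijective phi)
  (lift : forall f : {multiplicative gT -> gT},
     exists psi : {rmorphism R -> R}, forall g, phi (f g) = units_map psi (phi g)).

Local Open Scope ring_scope.

Let n_gt0 : (0 < n)%N := ltn_trans (isT : 0 < 2)%N n_gt2.

Let v (g : gT) : R := unit_val (phi g).

Lemma unit_rep1 : v 1%g = 1.
Proof. by rewrite /v multiplicative1. Qed.

Lemma unit_repM g h : v (g * h)%g = v g * v h.
Proof. by rewrite /v gmulfM. Qed.

Lemma unit_rep_inj : injective v.
Proof. by move=> g h /unit_val_inj; apply: bij_inj. Qed.

Lemma unit_rep_surj (a b : R) : a * b = 1 -> b * a = 1 -> exists g, v g = a.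
Proof.
move=> ab ba; have [_ /(_ (ex_intro _ b (conj ab ba)))[u <-]] := unit_valP a.
by case: phi_bij => phi' _ phi'K; exists (phi' u); rewrite /v phi'K.
Qed.

Lemma lift_endo (f : {multiplicative gT -> gT}) :
  exists psi : {rmorphism R -> R}, forall g, psi (v g) = v (f g).
Proof. by have [psi E] := lift f; exists psi => g; rewrite /v E. Qed.

(* The trivial endomorphism sends the unit -1 to 1, and its lift fixes -1. *)
Lemma realizing_ring_char2 (a : R) : a + a = 0.
Proof.
have N1 : (-1) * (-1) = 1 :> R by rewrite mulrNN mulr1.
have [g vg] := unit_rep_surj N1 N1.
have triv : dihedral_rel n (1 : gT)%g 1%g.
  by split; rewrite ?expg1n // mulg1 mulgV invg1.
have [f [fr fs]] := dihedral_endo n_gt0 gT_dihedral defG rs_rel triv.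
have [psi psiE] := lift_endo f.
have f1 : f g = 1%g.
  by have [k [->|->]] := dihedral_elt defG rs_rel g;
     rewrite ?gmulfM multiplicativeX fr ?fs expg1n ?mulg1.
have E : -1 = 1 :> R by rewrite -[RHS]unit_rep1 -f1 -psiE vg rmorphN1.
by rewrite -[X in X + _]mulr1 -{1}E mulrN1 addNr.
Qed.

Let R2 := realizing_ring_char2.
Let x := 1 + v s.

Lemma rep_rV : v r * v r^-1%g = 1.
Proof. by rewrite -unit_repM mulgV unit_rep1. Qed.

Lemma rep_Vr : v r^-1%g * v r = 1.
Proof. by rewrite -unit_repM mulVg unit_rep1. Qed.

Lemma rep_s2 : v s * v s = 1.
Proof. by have [_ s2 _] := rs_rel; rewrite -unit_repM -expg2 s2 unit_rep1. Qed.

Lemma rep_rs : v r * v s = v s * v r^-1%g.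
Proof. by rewrite -!unit_repM -(dihedral_conj rs_rel) -conjgC. Qed.

(** The lift of [r |-> 1], [s |-> s] detects rotations: since [s != 1], only powers of [r] are sent
    to 1. *)
Lemma retract_endo :
  exists psi : {rmorphism R -> R},
    [/\ psi (v r) = 1, psi (v s) = v s
      & forall g, psi (v g) = 1 -> exists k, g = (r ^+ k)%g].
Proof.
have [_ s2 _] := rs_rel.
have rel : dihedral_rel n (1 : gT)%g s.
  by split; rewrite ?expg1n // mulg1 mulgV invg1.
have [f [fr fs]] := dihedral_endo n_gt0 gT_dihedral defG rs_rel rel.
have [psi psiE] := lift_endo f; exists psi.
split=> [||g]; rewrite psiE ?fr ?fs ?unit_rep1 // -unit_rep1.
move/unit_rep_inj; have [k [->|->]] := dihedral_elt defG rs_rel g.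
  by exists k.
rewrite gmulfM multiplicativeX fr fs expg1n mul1g => s1.
by case/eqP: (dihedral_gen_neq1 n_gt0 gT_dihedral defG rs_rel).
Qed.

(** The retraction sends the unit [1 + x * v r * x] to [1 + x * x = 1], so this unit is a power of
    [r]. *)
Lemma rep_conj_comm : v r * (x * v r * x) = x * v r * x * v r.
Proof.
have x2 : x * x = 0 := involution_sq0 R2 rep_s2.
have c2 : x * v r * x * (x * v r * x) = 0.
  by rewrite -!mulrA [x * (x * _)]mulrA x2 mul0r !mulr0.
have [g vg] := unit_rep_surj (sq0_unit R2 c2) (sq0_unit R2 c2).
have [psi [psir psis ker]] := retract_endo.
have [|k gk] := ker g.
  by rewrite vg /x !(rmorphD, rmorphM, rmorph1) psir psis mulr1 x2 addr0.
have : v r * v g = v g * v r by rewrite -!unit_repM gk -expgS expgSr.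
by rewrite vg (mulrDr _ 1) (mulrDl 1 (x * _ * x)) mulr1 mul1r => /addrI.
Qed.

Lemma realizable_dihedral_eq4 : n = 4%N.
Proof.
have := rot_sq_eq R2 rep_rV rep_Vr rep_s2 rep_rs rep_conj_comm.
rewrite -!unit_repM => /unit_rep_inj rr.
have r4 : (r ^+ 4 = 1)%g.
  by rewrite (expgD r 2 2) !expg2 {1}rr -mulgA mulKg mulVg.
have : (n %| 4)%N.
  apply: dvdn_trans (dihedral_order n_gt0 gT_dihedral defG rs_rel) _.
  by rewrite order_dvdn r4.
by move: n_gt2; case: (n) => [|[|[|[|[|k]]]]] // _ /dvdn_leq; move/(_ isT).
Qed.

Lemma dihedral_not_realizable : False.
Proof.
have n4 := realizable_dihedral_eq4.
have [rn s2 rs] := rs_rel; rewrite n4 in rn.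
set d := x * (1 + v r).
have d3 : d * d * d = 0 := rot_cube0 R2 rep_s2 rep_conj_comm.
have [d1 d2] := cube0_unit R2 d3.
have [g vg] := unit_rep_surj d1 d2.
have [psi1 [psi1r psi1s ker]] := retract_endo.
(* [psi1] sends [1 + v r] to [1 + 1 = 0], hence [1 + d] to 1. *)
have [|k gk] := ker g.
  by rewrite vg /d /x !(rmorphD, rmorphM, rmorph1) psi1r R2 mulr0 addr0.
(* The map [r |-> s], [s |-> 1] respects the relations because [n = 4] is even. *)
have rel2 : dihedral_rel n s 1%g.
  have sV : (s^-1 = s)%g by apply/eqP; rewrite eq_invg_mul -expg2 s2.
  by split; rewrite ?expg1n ?mul1g ?invg1 ?mulg1 ?sV // n4 (expgM s 2 2) s2 expg1n.
have [f2 [f2r f2s]] := dihedral_endo n_gt0 gT_dihedral defG rs_rel rel2.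
have [psi2 psi2E] := lift_endo f2.
(* [psi2] kills [x], so it sends [v g] to 1, whereas [f2 g = s ^+ k]; hence [k] is even. *)
have sk : (s ^+ k = 1)%g.
  apply: unit_rep_inj; rewrite -f2r -multiplicativeX -gk -psi2E vg /d /x !(rmorphD, rmorphM, rmorph1) !psi2E.
  by rewrite f2s unit_rep1 R2 mul0r addr0.
have gV : (g^-1 = g)%g.
  apply/eqP; rewrite eq_invg_mul gk -expgD addnn -mul2n.
  have : (2 %| k)%N.
    have /prime_nt_dvdP <- //: (#[s]%g %| 2)%N by rewrite order_dvdn s2.
      by rewrite order_dvdn sk.
    by rewrite order_eq1 (dihedral_gen_neq1 n_gt0 gT_dihedral defG rs_rel).
  by case/dvdnP=> j ->; rewrite mulnCA mulnC (expgM r 4) rn expg1n.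
have rel3 : dihedral_rel n r^-1%g (s * r)%g.
  have srs : (s * r * s = r^-1)%g.
    by rewrite -rs; congr (_ * _)%g; apply/eqP; rewrite eq_sym eq_invg_mul -expg2 s2.
  split; first by rewrite expgVn n4 rn invg1.
    by rewrite expg2 mulgA srs mulVg.
  by rewrite invgM mulgK -[X in _ = (X^-1)%g]rs !invgM invgK.
have [f3 [f3r f3s]] := dihedral_endo n_gt0 gT_dihedral defG rs_rel rel3.
have [psi3 psi3E] := lift_endo f3.
(* [f3] inverts the powers of [r], and [g] is its own inverse. *)
have f3g : f3 g = g by rewrite -{2}gV gk multiplicativeX f3r expgVn.
have := psi3E g; rewrite f3g vg /d /x !(rmorphD, rmorphM, rmorph1) !psi3E f3r f3s.
rewrite unit_repM => /addrI.
(* Expanded, the two sides differ only in [v r^-1] against [v r]. *)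
rewrite !mulrDl !mul1r !mulrDr !mulr1 -mulrA rep_rV mulr1.
rewrite [v s * v r + v s]addrC => /addIr/addrI/unit_rep_inj rV.
have : (n %| 2)%N.
  apply: dvdn_trans (dihedral_order n_gt0 gT_dihedral defG rs_rel) _.
  by rewrite order_dvdn expg2 -{1}rV mulVg.
by rewrite n4.
Qed.

End NotRealizable.

Theorem theorem3p1 (n : nat) (gT : finGroupType)
  (n_ge1 : 1 <= n) (gT_dihedral : is_dihedral n gT) :
  fully_realizable gT <-> n = 1 \/ n = 2.
Proof.
split=> [[R [phi [phi_bij lift]]]|n12]; last first.
  apply: sq1_fully_realizable; apply: dihedral_sq1 n_ge1 _ gT_dihedral.
  by case: n12 => ->.
have [n_gt2|] := ltnP 2 n; last first.
  by case: n n_ge1 {gT_dihedral} => [|[|[|k]]] // _ _; [left | right].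
have [r [s [defG rs_rel]]] := dihedral_gen gT_dihedral.
by case: (dihedral_not_realizable n_gt2 gT_dihedral defG rs_rel phi_bij lift).
Qed.
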